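(* Let $1\le p\le n$, let $\widetilde G:St^n_p\to\mathbb R$ be a smooth function and let $G:\mathcal M_{n\times p}(\mathbb R)\cong\mathbb R^{np}\to\mathbb R$ be a smooth extension, $\widetilde G=G_{|St^n_p}$. A matrix $U\in\mathcal M_{n\times p}(\mathbb R)$ is a critical point of $\widetilde G$ (in particular $U\in St_p^n$) if and only if the following conditions are simultaneously satisfied: (i) $U^T\nabla G(U)=\nabla G(U)^TU$; (ii) $\nabla G(U)=UU^T\nabla G(U)$; (iii) $U^TU=\mathbb I_p$.
   Context: $St_p^n=\{U\in\mathcal M_{n\times p}(\mathbb R)\mid U^TU=\mathbb I_p\}$ is the orthogonal Stiefel manifold. $\mathcal M_{n\times p}(\mathbb R)$ is identified with $\mathbb R^{np}$ by stacking columns, and $\nabla G(U)\in\mathcal M_{n\times p}(\mathbb R)$ is the Euclidean gradient of $G$ at $U$ written as a matrix, i.e. its $a$-th column is $\frac{\partial G}{\partial\mathbf u_a}$, the vector of partial derivatives with respect to the entries of the $a$-th column $\mathbf u_a$ of $U$. *)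

(* Defs.v *)
From HB Require Import structures.
From mathcomp Require Import all_boot all_order all_algebra.
From mathcomp Require Import all_classical all_reals all_analysis.

Set Implicit Arguments.
Unset Strict Implicit.
Unset Printing Implicit Defensive.

Import Order.TTheory GRing.Theory Num.Theory.
Import numFieldNormedType.Exports.

Local Open Scope classical_set_scope.
Local Open Scope ring_scope.

(* Intended for an open set [A] and finite-dimensional [V], where [f] is of
   class C^(k+1) iff it is differentiable and each map [x |-> 'd f x v] is of
   class C^k; for a differentiable [f], ['D_v f x] is ['d f x v]. *)
Fixpoint class_C (R : realType) (V W : normedModType R) (k : nat) (A : set V)
    (f : V -> W) : Prop :=
  if k is k'.+1 then
    (forall x, A x -> differentiable f x) /\
    (forall v : V, class_C k' A (fun x => 'D_v f x))
  else forall x, A x -> {for x, continuous f}.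

Definition smooth_on (R : realType) (V W : normedModType R) (A : set V)
    (f : V -> W) : Prop :=
  forall k, class_C k A f.

Definition stiefel (R : realType) (n p : nat) : Type :=
  {U : 'M[R]_(n, p) | U^T *m U == 1%:M}.

Definition stiefel_mx (R : realType) (n p : nat) (u : stiefel R n p) :
  'M[R]_(n, p) := sval u.

(* Smoothness of a function on an embedded submanifold: it is locally the
   restriction of a smooth function of the ambient space. *)
Definition stiefel_smooth (R : realType) (n p : nat)
    (f : stiefel R n p -> R) : Prop :=
  forall u : stiefel R n p,
    exists (A : set 'M[R]_(n, p)) (F : 'M[R]_(n, p) -> R),
      [/\ open A, A (stiefel_mx u), smooth_on A F &
          forall w : stiefel R n p, A (stiefel_mx w) -> f w = F (stiefel_mx w)].

(* Only the germ of [c] at [0] matters, so that [c] stands for a smooth curve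
   ]-e, e[ -> St extended arbitrarily to the whole line. *)
Definition smooth_curve_at (R : realType) (n p : nat) (u : stiefel R n p)
    (c : R -> stiefel R n p) : Prop :=
  c 0 = u /\
  exists2 e : R, 0 < e & smooth_on (ball (0 : R) e) (fun t => stiefel_mx (c t)).

(* The differential of [f] at [u] vanishes: tangent vectors at [u] are the
   velocities c'(0) of the smooth curves [c] in the manifold with [c 0 = u],
   and df_u (c'(0)) = (f \o c)'(0). *)
Definition critical_point (R : realType) (n p : nat)
    (f : stiefel R n p -> R) (U : 'M[R]_(n, p)) : Prop :=
  exists2 u : stiefel R n p, stiefel_mx u = U &
    forall c : R -> stiefel R n p, smooth_curve_at u c ->
      is_derive (0 : R) (1 : R) (fun t => f (c t)) 0.

Definition gradient (R : realType) (n p : nat) (G : 'M[R]_(n, p) -> R)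
    (U : 'M[R]_(n, p)) : 'M[R]_(n, p) :=
  \matrix_(i < n, a < p) 'D_(delta_mx i a) G U.

(* Main.v *)
Require Import Defs.
From HB Require Import structures.
From mathcomp Require Import all_boot all_order all_algebra.
From mathcomp Require Import all_classical all_reals all_analysis.
From mathcomp Require Import ring.

(* By the chain rule, U is critical iff tr (g^T V) = 0 for the velocity V at U
   of every curve in the manifold, where g is the gradient of G at U. The
   rotations of the coordinate planes give the velocities
   V = (E_ij - E_ji) U, for which the condition says that U g^T is symmetric;
   multiplying U g^T = g U^T by U and using U^T U = 1 yields (ii), then (i).
   Conversely every velocity satisfies V^T U + U^T V = 0, so by (ii)
   tr (g^T V) = tr ((g^T U) (U^T V)) is the trace of a product of a symmetric
   matrix, by (i), and a skew-symmetric one, hence vanishes. *)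

Set Implicit Arguments.
Unset Strict Implicit.
Unset Printing Implicit Defensive.

Import Order.TTheory GRing.Theory Num.Theory.
Import numFieldNormedType.Exports.

Local Open Scope classical_set_scope.
Local Open Scope ring_scope.

(** * Trace identities and the linear algebra of the three conditions *)

Lemma mxtrace_delta_mull (R : comPzRingType) (n : nat) (i j : 'I_n)
    (M : 'M[R]_n) : \tr (delta_mx i j *m M) = M j i.
Proof.
rewrite /mxtrace (bigD1 i) //= big1 => [|k ki]; last first.
  by rewrite mxE big1 // => l _; rewrite mxE (negbTE ki) mul0r.
rewrite addr0 mxE (bigD1 j) //= mxE !eqxx mul1r big1 ?addr0 // => l lj.
by rewrite mxE (negbTE lj) andbF mul0r.
Qed.

(** Transposing and then cycling the trace shows that it equals its own opposite. *)
Lemma mxtrace_sym_skew (R : numFieldType) (n : nat) (S K : 'M[R]_n) :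
  S^T = S -> K^T = - K -> \tr (S *m K) = 0.
Proof.
move=> Ssym Kskew; suff /eqP : \tr (S *m K) *+ 2 = 0.
  by rewrite mulrn_eq0 => /eqP.
rewrite mulr2n -{1}mxtrace_tr trmx_mul Ssym Kskew mulNmx mxtrace_mulC.
by rewrite raddfN /= mxtrace_mulC addNr.
Qed.

Section CriticalAlgebra.
Variables (R : numFieldType) (n p : nat) (U g : 'M[R]_(n, p)).
Hypothesis UtU : U^T *m U = 1%:M.

Lemma stiefel_gradient_cond :
  U *m g^T = g *m U^T ->
  U^T *m g = g^T *m U /\ g = U *m U^T *m g.
Proof.
move=> sym.
have gE : g = U *m (g^T *m U) by rewrite mulmxA sym -mulmxA UtU mulmx1.
have gtE : g^T *m U = U^T *m g by rewrite {2}gE mulmxA UtU mul1mx.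
by split; rewrite // -mulmxA -gtE.
Qed.

Lemma stiefel_gradient_tangent (V : 'M[R]_(n, p)) :
  U^T *m g = g^T *m U -> g = U *m U^T *m g ->
  V^T *m U + U^T *m V = 0 -> \tr (g^T *m V) = 0.
Proof.
move=> sym gE /eqP; rewrite addr_eq0 => /eqP tanV.
rewrite gE !trmx_mul trmxK -!mulmxA mulmxA.
apply: mxtrace_sym_skew; first by rewrite trmx_mul trmxK sym.
by rewrite trmx_mul trmxK tanV.
Qed.

End CriticalAlgebra.

(** * Rotations of the coordinate planes *)

Section Rotation.
Variables (R : realType) (n : nat).

Definition rot_generator (i j : 'I_n) : 'M[R]_n := delta_mx i j - delta_mx j i.

Lemma trmx_rot_generator i j : (rot_generator i j)^T = - rot_generator i j.
Proof. by rewrite linearB /= !trmx_delta opprB. Qed.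

(** For [i != j], [A] is a quarter turn of the plane of the two coordinates and kills the others, so
    [A *m A] is minus the projection onto that plane; for [i = j], [A] is 0. *)
Lemma rot_generator3 i j (A := rot_generator i j) : A *m (A *m A) = - A.
Proof.
rewrite /A /rot_generator; have [->|ij] := eqVneq i j.
  by rewrite subrr mul0mx oppr0.
rewrite !(mulmxBl, mulmxBr) !mul_delta_mx_cond !eqxx (negbTE ij).
rewrite [j == i]eq_sym (negbTE ij) !mulr0n !mulr1n !(mulmxBl, mulmxBr, mulmx0).
rewrite !mul_delta_mx_cond !eqxx (negbTE ij) [j == i]eq_sym (negbTE ij).
by rewrite /= !mulr0n !mulr1n !(oppr0, sub0r, subr0, addr0) -opprD.
Qed.

(* The one-parameter group exp(tA), in closed form because A^3 = -A. *)
Definition rotation (A : 'M[R]_n) (t : R) : 'M[R]_n :=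
  1%:M + sin t *: A + (1 - cos t) *: (A *m A).

Lemma rotation0 A : rotation A 0 = 1%:M.
Proof. by rewrite /rotation sin0 cos0 subrr !scale0r !addr0. Qed.

(** By [A^3 = -A] the span of 1, [A] and [D = A^2] is closed under products, so the claim reduces to
    scalar identities that follow from [cos^2 + sin^2 = 1]. *)
Lemma rotation_orthogonal (A : 'M[R]_n) (t : R) :
  A^T = - A -> A *m (A *m A) = - A -> (rotation A t)^T *m rotation A t = 1%:M.
Proof.
move=> skewA A3; pose D := A *m A.
have AD : A *m D = - A by [].
have DA : D *m A = - A by rewrite -mulmxA.
have DD : D *m D = - D by rewrite {1}/D -mulmxA AD mulmxN.
have Dt : D^T = D by rewrite trmx_mul skewA mulNmx mulmxN opprK.
have -> : (rotation A t)^T = 1%:M - sin t *: A + (1 - cos t) *: D.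
  by rewrite /rotation !linearD !linearZ /= trmx1 Dt skewA scalerN.
rewrite /rotation -/D.
rewrite !(mulmxDl, mulmxDr, mul1mx, mulmx1) -!scalemxAl -!scalemxAr.
rewrite !mulNmx -!scalemxAl AD DA DD -/D.
apply/matrixP => i j; rewrite !mxE.
have := cos2Dsin2 t; set s := sin t; set c := cos t => cs.
have s2 : s ^+ 2 = 1 - c ^+ 2 by rewrite -cs; ring.
by ring: s2.
Qed.

End Rotation.

(** * Derivatives along curves of matrices *)

Section Calculus.
Variables (R : realType) (n p : nat).

Lemma diff_gradient (G : 'M[R]_(n, p) -> R) (U V : 'M[R]_(n, p)) :
  differentiable G U -> 'd G U V = \tr ((gradient G U)^T *m V).
Proof.
move=> dG; rewrite {1}(matrix_sum_delta V) linear_sum /mxtrace /=.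
under eq_bigr do rewrite linear_sum; under [RHS]eq_bigr do rewrite mxE.
rewrite exchange_big /=; apply: eq_bigr => j _; apply: eq_bigr => i _.
by rewrite linearZ /= !mxE deriveE // mulrC.
Qed.

Lemma is_derive_along (G : 'M[R]_(n, p) -> R) (c : R -> 'M[R]_(n, p)) (t : R) :
  differentiable c t -> differentiable G (c t) ->
  is_derive t 1 (fun s => G (c s)) (\tr ((gradient G (c t))^T *m 'D_1 c t)).
Proof.
move=> dc dG; have dGc : differentiable (G \o c) t by exact: differentiable_comp.
apply: DeriveDef; first exact: diff_derivable.
rewrite (_ : (fun s => _) = G \o c) // deriveE // diff_comp //=.
by rewrite diff_gradient // -deriveE.
Qed.

Lemma is_derive_gram (c : R -> 'M[R]_(n, p)) (t : R) :
  derivable c t 1 ->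
  is_derive t 1 (fun s => (c s)^T *m c s)
    (('D_1 c t)^T *m c t + (c t)^T *m 'D_1 c t).
Proof.
move=> dc; have dcij := (derivable_mxP _ _ _).1 dc.
have dgram i j : is_derive t 1 (fun s => ((c s)^T *m c s) i j)
    ((('D_1 c t)^T *m c t + (c t)^T *m 'D_1 c t) i j).
  rewrite (_ : (fun s => _) =
      \sum_(k < n) ((fun s => c s k i) * (fun s => c s k j))); last first.
    apply/funext => s; rewrite mxE fct_sumE; apply: eq_bigr => k _.
    by rewrite mxE.
  have dk (k : 'I_n) : is_derive t 1 ((fun s => c s k i) * (fun s => c s k j))
      (c t k i *: 'D_1 (fun s => c s k j) t + c t k j *: 'D_1 (fun s => c s k i) t).
    by apply: is_deriveM; exact: derivableP.
  apply: is_derive_eq; rewrite derive_mx // !mxE -big_split /=.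
  apply: eq_bigr => k _; rewrite !mxE addrC; congr (_ + _).
  exact: mulrC.
have dg : derivable (fun s => (c s)^T *m c s) t 1.
  by apply/derivable_mxP => i j; have [] := dgram i j.
apply: DeriveDef => //; rewrite derive_mx //; apply/matrixP => i j.
by rewrite mxE; have [] := dgram i j.
Qed.

(** The Gram matrix is constantly 1 along the curve, so its derivative vanishes. *)
Lemma stiefel_velocity_tangent (c : R -> stiefel R n p) (t : R)
    (g := fun s => stiefel_mx (c s)) :
  derivable g t 1 -> ('D_1 g t)^T *m g t + (g t)^T *m 'D_1 g t = 0.
Proof.
move=> dg; have [_ <-] := is_derive_gram dg.
rewrite (_ : (fun s => _) = cst 1%:M) ?derive_cst //.
by apply/funext => s; apply/eqP; exact: (svalP (c s)).
Qed.

(** A family that contains the orbits [rotation A t *m U] and is stable under differentiation, which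
    makes smoothness a plain induction. *)
Definition trig_curve (A B C : 'M[R]_(n, p)) (t : R) : 'M[R]_(n, p) :=
  sin t *: A + cos t *: B + C.

(** The direction [v] is arbitrary because [class_C] quantifies over all directions, even on the
    line. *)
Lemma is_derive_scalel (f : R -> R) (A : 'M[R]_(n, p)) (t v df : R) :
  is_derive t 1 f df -> is_derive t v (fun s => f s *: A) ((v * df) *: A).
Proof.
move=> [/derivable1_diffP dft <-].
have dfA : differentiable (fun s => f s *: A) t by exact: differentiableZl.
apply: DeriveDef; first exact: diff_derivable.
rewrite (deriveE v dfA) (diffZl A dft) (deriveE (1 : R) dft).
by congr (_ *: _); rewrite -[v in LHS]mulr1 linearZ.
Qed.

Lemma is_derive_trig_curve A B C (t v : R) :
  is_derive t v (trig_curve A B C) (trig_curve (- v *: B) (v *: A) 0 t).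
Proof.
have -> : trig_curve A B C =
    (fun s => sin s *: A) + (fun s => cos s *: B) + cst C.
  by [].
have dsin := is_derive_scalel A v (is_derive_sin t).
have dcos := is_derive_scalel B v (is_derive_cos t).
have dC := is_derive_cst C t v.
have := is_deriveD (is_deriveD dsin dcos) dC.
congr is_derive.
rewrite /trig_curve !addr0 addrC !scalerA.
by congr (_ *: _ + _ *: _); rewrite mulrC ?mulNr ?mulrN.
Qed.

Lemma smooth_trig_curve (D : set R) A B C : smooth_on D (trig_curve A B C).
Proof.
move=> k; elim: k A B C => [|k IHk] A B C /=.
  move=> t _; apply/differentiable_continuous/derivable1_diffP.
  by have [] := is_derive_trig_curve A B C t 1.
split=> [t _|v].
  by apply/derivable1_diffP; have [] := is_derive_trig_curve A B C t 1.
rewrite (_ : (fun t => _) = trig_curve (- v *: B) (v *: A) 0) //.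
by apply/funext => t; have [] := is_derive_trig_curve A B C t v.
Qed.

Lemma rotation_mulE (A : 'M[R]_n) (U : 'M[R]_(n, p)) :
  (fun t => rotation A t *m U) =
  trig_curve (A *m U) (- (A *m A *m U)) (U + A *m A *m U).
Proof.
apply/funext => t; rewrite /rotation /trig_curve !mulmxDl mul1mx -!scalemxAl.
apply/matrixP => i j; rewrite !mxE; ring.
Qed.

End Calculus.

Theorem theorem3p3 (R : realType) (n p : nat) (hp : (1 <= p)%N) (hpn : (p <= n)%N)
    (Gt : stiefel R n p -> R) (hGt : stiefel_smooth Gt)
    (G : 'M[R]_(n, p) -> R) (hG : smooth_on setT G)
    (hext : forall u : stiefel R n p, Gt u = G (stiefel_mx u))
    (U : 'M[R]_(n, p)) :
  critical_point Gt U <->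
  [/\ U^T *m gradient G U = (gradient G U)^T *m U,
      gradient G U = U *m U^T *m gradient G U &
      U^T *m U = 1%:M].
Proof.
have dG V : differentiable G V by have [dG _] := hG 1%N; exact: dG.
have dGt (c : R -> stiefel R n p) : differentiable (fun t => stiefel_mx (c t)) (0 : R) ->
    is_derive (0 : R) (1 : R) (fun t => Gt (c t))
      (\tr ((gradient G (stiefel_mx (c 0)))^T *m 'D_1 (fun t => stiefel_mx (c t)) (0 : R))).
  move=> dc; have := is_derive_along dc (dG _).
  by congr is_derive; apply/funext => t; rewrite hext.
set g := gradient G U; split.
  move=> [u uU crit].
  have UtU : U^T *m U = 1%:M by apply/eqP; rewrite -uU; exact: (svalP u).
  suff /(stiefel_gradient_cond UtU)[? ?] : U *m g^T = g *m U^T by split.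
  (* The indices are swapped because [\tr (delta_mx j i *m M) = M i j]: for the velocity [A *m U] at
     0, the trace becomes the [(i, j)] entry of [U *m g^T] minus its [(j, i)] entry. *)
  apply/matrixP => i j; pose A : 'M[R]_n := rot_generator R j i.
  have orthA t : (rotation A t *m U)^T *m (rotation A t *m U) == 1%:M.
    rewrite trmx_mul -mulmxA [X in _ *m X]mulmxA.
    by rewrite rotation_orthogonal ?mul1mx ?UtU ?trmx_rot_generator
      ?rot_generator3.
  pose c t : stiefel R n p :=
    exist (fun W : 'M[R]_(n, p) => W^T *m W == 1%:M) _ (orthA t).
  have cE : (fun t => stiefel_mx (c t)) =
      trig_curve (A *m U) (- (A *m A *m U)) (U + A *m A *m U).
    exact: rotation_mulE.
  have c0 : c 0 = u.
    by apply: val_inj; rewrite /= rotation0 mul1mx -uU.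
  have Dc := is_derive_trig_curve
    (A *m U) (- (A *m A *m U)) (U + A *m A *m U) 0 1.
  rewrite -cE in Dc.
  have dc : differentiable (fun t => stiefel_mx (c t)) (0 : R).
    by apply/derivable1_diffP; case: Dc.
  have [|_ crit0] := crit c.
    (* The radius 1 is arbitrary, as a trigonometric curve is smooth on any set. *)
    split=> //; exists 1 => //; rewrite [X in smooth_on _ X]cE.
    exact: smooth_trig_curve.
  have [_] := dGt c dc; rewrite crit0 c0 uU -/g; case: Dc => _ ->.
  rewrite /trig_curve sin0 cos0 scale0r add0r !scale1r addr0.
  rewrite mxtrace_mulC -mulmxA mulmxBl raddfB /= !mxtrace_delta_mull.
  move/esym/eqP.
  rewrite subr_eq0 => /eqP ->.
  by rewrite (_ : g *m U^T = (U *m g^T)^T) ?mxE // trmx_mul trmxK.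
move=> [sym gE UtU].
have UtUb : U^T *m U == 1%:M by apply/eqP.
exists (exist _ U UtUb) => // c [c0 [e e0 smc]].
have dc : differentiable (fun t => stiefel_mx (c t)) (0 : R).
  (* Class C^1 on the ball already gives differentiability at its centre. *)
  by have [dc _] := smc 1%N; apply: dc; exact: ballxx.
have cU : stiefel_mx (c 0) = U by rewrite c0.
apply: is_derive_eq (dGt c dc) _; rewrite cU.
apply: (stiefel_gradient_tangent sym gE).
have := stiefel_velocity_tangent ((derivable1_diffP _ _).2 dc).
by rewrite cU.
Qed.
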